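(* The Lie algebra $\mathfrak{D}$ is isomorphic to the Lie algebra $\mathcal{A}^{\tau}$ with $d^{\alpha,r}$ corresponding to $G^{\tau}_{-\alpha,r}$ $(=-G^{\tau}_{\alpha,r})$ for $\alpha,r\in\mathbb{Z}$, and $\mathfrak{D}$ has a basis $\{d^{\alpha,r}\mid\alpha,r\in\mathbb{Z},\ \alpha\ge1\}$. Furthermore, the bilinear form $\langle\cdot,\cdot\rangle$ on $\mathfrak{D}$ defined by $$\langle d^{\alpha,r},d^{\beta,s}\rangle=\delta_{r,s}\left(\delta_{\alpha-\beta,0}-\delta_{\alpha+\beta,0}\right)\quad\text{for }\alpha,\beta,r,s\in\mathbb{Z}$$ is symmetric and invariant.
   Context: All Lie algebras are over $\mathbb{C}$. $\mathfrak{D}$ is the Lie algebra with generators $d^{\alpha,r}$ ($\alpha,r\in\mathbb{Z}$), subject to the relations $d^{-\alpha,r}=-d^{\alpha,r}$ and $$[d^{\alpha,r},d^{\beta,s}]=\delta_{\alpha+\beta,s-r}d^{\alpha+\beta,-\alpha+s}-\delta_{\alpha+\beta,r-s}d^{\alpha+\beta,\alpha+s}-\delta_{\alpha-\beta,s-r}d^{\alpha-\beta,-\alpha+s}+\delta_{\alpha-\beta,r-s}d^{\alpha-\beta,\alpha+s}$$ for $\alpha,\beta,r,s\in\mathbb{Z}$. $\mathfrak{gl}_{\infty}$ is the Lie algebra of doubly infinite complex matrices (rows and columns indexed by $\mathbb{Z}$) with only finitely many nonzero entries, with basis the matrix units $E_{m,n}$ ($m,n\in\mathbb{Z}$). $\mathcal{A}=\mathrm{span}\{E_{m,n}\mid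 m,n\in\mathbb{Z},\ m+n\in2\mathbb{Z}\}$, a Lie subalgebra. $\tau$ is the order-$2$ automorphism of $\mathfrak{gl}_\infty$ with $\tau(E_{m,n})=-E_{n,m}$; it preserves $\mathcal{A}$, and $\mathcal{A}^{\tau}$ is the Lie subalgebra of $\tau$-fixed points in $\mathcal{A}$. For $\alpha,m\in\mathbb{Z}$, $G^{\tau}_{\alpha,m}=E_{m+\alpha,m-\alpha}-E_{m-\alpha,m+\alpha}\in\mathcal{A}^\tau$. A bilinear form on a Lie algebra is invariant if $\langle[a,b],c\rangle=\langle a,[b,c]\rangle$ for all $a,b,c$. *)

(* Defs.v *)
From HB Require Import structures.
From mathcomp Require Import all_boot all_order all_algebra.
From mathcomp Require Import ring complex.
From mathcomp Require Import boolp classical_sets functions cardinality fsbigop.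
From mathcomp Require Import reals.

Set Implicit Arguments.
Unset Strict Implicit.
Unset Printing Implicit Defensive.

Import Order.TTheory GRing.Theory Num.Theory.
Local Open Scope ring_scope.
Local Open Scope classical_set_scope.
Local Open Scope quotient_scope.

HB.mixin Record Lmodule_isLieAlgebra (K : fieldType) L
    & GRing.Lmodule K L := {
  lie : L -> L -> L;
  lie_bilinear : bilinear_for *:%R *:%R lie;
  liexx : forall x, lie x x = 0;
  lie_jacobi : forall x y z,
    lie x (lie y z) + lie y (lie z x) + lie z (lie x y) = 0
}.

#[short(type="lieAlgType")]
HB.structure Definition LieAlgebra (K : fieldType) :=
  { L of Lmodule_isLieAlgebra K L & GRing.Lmodule K L }.

Section LieGeneral.
Variable K : fieldType.

Definition lie_hom (L M : lieAlgType K) (f : L -> M) : Prop :=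
  linear f /\ forall x y, f (lie x y) = lie (f x) (f y).

Definition lie_iso (L M : lieAlgType K) (f : L -> M) : Prop :=
  lie_hom f /\ bijective f.

Definition form_invariant (L : lieAlgType K) (B : L -> L -> K) : Prop :=
  forall a b c, B (lie a b) c = B a (lie b c).

Definition form_symmetric (L : lieAlgType K) (B : L -> L -> K) : Prop :=
  forall a b, B a b = B b a.

Definition lin_span (V : lmodType K) (X : set V) : set V :=
  [set v | exists (n : nat) (a : 'I_n -> K) (x : 'I_n -> V),
     (forall i, X (x i)) /\ v = \sum_(i < n) a i *: x i].

Definition basis_of_family (V : lmodType K) (I : choiceType) (P : set I)
    (v : I -> V) : Prop :=
  (forall (s : seq I) (a : I -> K), uniq s -> (forall i, i \in s -> P i) ->
     \sum_(i <- s) a i *: v i = 0 -> forall i, i \in s -> a i = 0) /\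
  lin_span (v @` P) = [set: V].

Section Span.
Variables (V : lmodType K) (X : set V).

Lemma lin_span0 : lin_span X 0.
Proof.
exists 0%N, (fun=> 0), (fun=> 0); split; first by case.
by rewrite big_ord0.
Qed.

Lemma lin_span_gen x : X x -> lin_span X x.
Proof.
by move=> Xx; exists 1%N, (fun=> 1), (fun=> x); rewrite big_ord1 scale1r.
Qed.

Lemma lin_spanD u v : lin_span X u -> lin_span X v -> lin_span X (u + v).
Proof.
move=> [m [a [x [Xx ->]]]] [n [b [y [Xy ->]]]].
exists (m + n)%N, (fun i : 'I_(m + n) => match fintype.split i with inl j => a j | inr k => b k end),
  (fun i : 'I_(m + n) => match fintype.split i with inl j => x j | inr k => y k end); split.
  by move=> i; case: fintype.split.
rewrite big_split_ord /=; congr (_ + _); apply: eq_bigr => i _.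
  by rewrite (unsplitK (inl i : 'I_m + 'I_n)%type).
by rewrite (unsplitK (inr i : 'I_m + 'I_n)%type).
Qed.

Lemma lin_spanZ a u : lin_span X u -> lin_span X (a *: u).
Proof.
move=> [n [b [x [Xx ->]]]]; exists n, (fun i => a * b i), x; split=> //.
by rewrite scaler_sumr; apply: eq_bigr => i _; rewrite scalerA.
Qed.

Lemma lin_span_lin a u v :
  lin_span X u -> lin_span X v -> lin_span X (a *: u + v).
Proof. by move=> Xu Xv; exact/lin_spanD/Xv/lin_spanZ. Qed.

Lemma lin_span_sum n (F : 'I_n -> V) :
  (forall i, lin_span X (F i)) -> lin_span X (\sum_(i < n) F i).
Proof.
by move=> XF; apply: big_ind => //; [exact: lin_span0 | exact: lin_spanD].
Qed.

End Span.

Section Bracket.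
Variable L : lieAlgType K.
Implicit Types x y z : L.

Lemma lieDl x y z : lie (x + y) z = lie x z + lie y z.
Proof. by have := (@lie_bilinear K L).1 z 1 x y; rewrite /= !scale1r. Qed.

Lemma lieDr x y z : lie x (y + z) = lie x y + lie x z.
Proof. by have := (@lie_bilinear K L).2 x 1 y z; rewrite /= !scale1r. Qed.

Lemma lie0l x : lie 0 x = 0.
Proof. by apply: (addrI (lie 0 x)); rewrite -lieDl !addr0. Qed.

Lemma lie0r x : lie x 0 = 0.
Proof. by apply: (addrI (lie x 0)); rewrite -lieDr !addr0. Qed.

Lemma lieZl a x y : lie (a *: x) y = a *: lie x y.
Proof.
by have := (@lie_bilinear K L).1 y a x 0; rewrite /= lie0l !addr0.
Qed.

Lemma lieZr a x y : lie x (a *: y) = a *: lie x y.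
Proof.
by have := (@lie_bilinear K L).2 x a y 0; rewrite /= lie0r !addr0.
Qed.

Lemma lieNl x y : lie (- x) y = - lie x y.
Proof. by rewrite -scaleN1r lieZl scaleN1r. Qed.

Lemma lieNr x y : lie x (- y) = - lie x y.
Proof. by rewrite -scaleN1r lieZr scaleN1r. Qed.

Lemma lieC x y : lie x y = - lie y x.
Proof.
apply/eqP; rewrite -addr_eq0; apply/eqP.
by have := liexx (x + y); rewrite lieDl !lieDr !liexx add0r addr0.
Qed.

Lemma lie_suml y n (F : 'I_n -> L) :
  lie (\sum_(i < n) F i) y = \sum_(i < n) lie (F i) y.
Proof.
exact: (big_morph (lie^~ y) (fun u v => lieDl u v y) (lie0l y)).
Qed.

Lemma lie_sumr x n (F : 'I_n -> L) :
  lie x (\sum_(i < n) F i) = \sum_(i < n) lie x (F i).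
Proof. exact: (big_morph (lie x) (fun u v => lieDr x u v) (lie0r x)). Qed.

Lemma lin_span_lie (X : set L) :
  (forall x y, X x -> X y -> lin_span X (lie x y)) ->
  forall u v, lin_span X u -> lin_span X v -> lin_span X (lie u v).
Proof.
move=> Xlie _ _ [m [a [x [Xx ->]]]] [n [b [y [Xy ->]]]].
rewrite lie_suml; apply: lin_span_sum => i.
rewrite lie_sumr; apply: lin_span_sum => j.
by rewrite lieZl lieZr; do 2!apply: lin_spanZ; exact: Xlie.
Qed.

End Bracket.
End LieGeneral.

Record lieSubalg (K : fieldType) (L : lieAlgType K) := LieSubalg {
  subalg_set : set L;
  subalg0 : subalg_set 0;
  subalg_lin : forall a u v,
    subalg_set u -> subalg_set v -> subalg_set (a *: u + v);
  subalg_lie : forall u v,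
    subalg_set u -> subalg_set v -> subalg_set (lie u v)
}.

Section SubalgType.
Variables (K : fieldType) (L : lieAlgType K) (S : lieSubalg L).

Definition subalg_pred : {pred L} := fun x => `[< subalg_set S x >].

Lemma subalg_predP x : reflect (subalg_set S x) (x \in subalg_pred).
Proof. exact: asboolP. Qed.

Lemma subalg_pred_closed : submod_closed subalg_pred.
Proof.
split; first by apply/subalg_predP; exact: subalg0.
move=> a u v /subalg_predP Su /subalg_predP Sv.
by apply/subalg_predP; exact: subalg_lin.
Qed.

HB.instance Definition _ :=
  GRing.isSubmodClosed.Build K L subalg_pred subalg_pred_closed.

Definition subalg_type : Type := {x : L | x \in subalg_pred}.
HB.instance Definition _ := SubType.copy subalg_type {x : L | x \in subalg_pred}.
HB.instance Definition _ := [Choice of subalg_type by <:].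
HB.instance Definition _ := [SubChoice_isSubLmodule of subalg_type by <:].

Definition to_subalg (x : L) (Sx : subalg_set S x) : subalg_type :=
  Sub x (introT (subalg_predP x) Sx).

Lemma subalg_typeP (x : subalg_type) : subalg_set S (val x).
Proof. exact/subalg_predP/(valP x). Qed.

Definition sublie (x y : subalg_type) : subalg_type :=
  to_subalg (subalg_lie (subalg_typeP x) (subalg_typeP y)).

Lemma val_sublie x y : val (sublie x y) = lie (val x) (val y).
Proof. by []. Qed.

Lemma val_subalg0 : val (0 : subalg_type) = 0. Proof. by []. Qed.
Lemma val_subalgD (x y : subalg_type) : val (x + y) = val x + val y.
Proof. by []. Qed.
Lemma val_subalgN (x : subalg_type) : val (- x) = - val x.
Proof. by []. Qed.
Lemma val_subalgZ a (x : subalg_type) : val (a *: x) = a *: val x.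
Proof. by []. Qed.

Lemma sublie_bilinear : bilinear_for *:%R *:%R sublie.
Proof.
split=> [z a x y|z a x y]; apply: val_inj.
  rewrite val_subalgD val_subalgZ !val_sublie val_subalgD val_subalgZ.
  by rewrite lieDl lieZl.
rewrite val_subalgD val_subalgZ !val_sublie val_subalgD val_subalgZ.
by rewrite lieDr lieZr.
Qed.

Lemma subliexx x : sublie x x = 0.
Proof. by apply: val_inj; rewrite val_sublie liexx. Qed.

Lemma sublie_jacobi x y z :
  sublie x (sublie y z) + sublie y (sublie z x) + sublie z (sublie x y) = 0.
Proof.
apply: val_inj; rewrite !val_subalgD !val_sublie val_subalg0.
exact: lie_jacobi.
Qed.

HB.instance Definition _ := Lmodule_isLieAlgebra.Build K subalg_type
  sublie_bilinear subliexx sublie_jacobi.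

End SubalgType.

Inductive lie_term (K X : Type) : Type :=
| LGen of X
| LZero
| LOpp of lie_term K X
| LAdd of lie_term K X & lie_term K X
| LScale of K & lie_term K X
| LBr of lie_term K X & lie_term K X.
Arguments LGen {K X}.
Arguments LZero {K X}.

HB.instance Definition _ (K X : Type) := gen_eqMixin (lie_term K X).
HB.instance Definition _ (K X : Type) := gen_choiceMixin (lie_term K X).

(* The quotient of terms by this congruence is the Lie algebra with generators
   X and relations rel; see lie_pres_universal below. *)
Inductive lie_eq (K : fieldType) (X : Type)
    (rel : lie_term K X -> lie_term K X -> Prop) :
    lie_term K X -> lie_term K X -> Prop :=
| LE_rel t u : rel t u -> lie_eq rel t u
| LE_refl t : lie_eq rel t t
| LE_sym t u : lie_eq rel t u -> lie_eq rel u t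
| LE_trans t u v : lie_eq rel t u -> lie_eq rel u v -> lie_eq rel t v
| LE_opp t t' : lie_eq rel t t' -> lie_eq rel (LOpp t) (LOpp t')
| LE_add t t' u u' : lie_eq rel t t' -> lie_eq rel u u' ->
    lie_eq rel (LAdd t u) (LAdd t' u')
| LE_scale a t t' : lie_eq rel t t' -> lie_eq rel (LScale a t) (LScale a t')
| LE_br t t' u u' : lie_eq rel t t' -> lie_eq rel u u' ->
    lie_eq rel (LBr t u) (LBr t' u')
| LE_addA t u v : lie_eq rel (LAdd t (LAdd u v)) (LAdd (LAdd t u) v)
| LE_addC t u : lie_eq rel (LAdd t u) (LAdd u t)
| LE_add0 t : lie_eq rel (LAdd LZero t) t
| LE_addN t : lie_eq rel (LAdd (LOpp t) t) LZero
| LE_scaleA a b t : lie_eq rel (LScale a (LScale b t)) (LScale (a * b) t)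
| LE_scale1 t : lie_eq rel (LScale 1 t) t
| LE_scaleDr a t u :
    lie_eq rel (LScale a (LAdd t u)) (LAdd (LScale a t) (LScale a u))
| LE_scaleDl a b t :
    lie_eq rel (LScale (a + b) t) (LAdd (LScale a t) (LScale b t))
| LE_brl a t u v :
    lie_eq rel (LBr (LAdd (LScale a t) u) v)
               (LAdd (LScale a (LBr t v)) (LBr u v))
| LE_brr a t u v :
    lie_eq rel (LBr v (LAdd (LScale a t) u))
               (LAdd (LScale a (LBr v t)) (LBr v u))
| LE_brxx t : lie_eq rel (LBr t t) LZero
| LE_jacobi t u v :
    lie_eq rel
      (LAdd (LAdd (LBr t (LBr u v)) (LBr u (LBr v t))) (LBr v (LBr t u)))
      LZero.

Section Presentation.
Variables (K : fieldType) (X : Type).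
Variable rel : lie_term K X -> lie_term K X -> Prop.

Definition lie_eqb (t u : lie_term K X) : bool := `[< lie_eq rel t u >].

Lemma lie_eqb_refl : reflexive lie_eqb.
Proof. by move=> t; apply/asboolP; exact: LE_refl. Qed.

Lemma lie_eqb_sym : symmetric lie_eqb.
Proof. by move=> t u; apply/asboolP/asboolP; exact: LE_sym. Qed.

Lemma lie_eqb_trans : transitive lie_eqb.
Proof.
move=> u t v /asboolP tu /asboolP uv; apply/asboolP; exact: LE_trans tu uv.
Qed.

Canonical lie_equiv := EquivRel lie_eqb lie_eqb_refl lie_eqb_sym lie_eqb_trans.

Definition lie_pres : Type := {eq_quot lie_equiv}.
HB.instance Definition _ := Choice.on lie_pres.

Definition pres_class (t : lie_term K X) : lie_pres := \pi_{eq_quot lie_equiv} t.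

Lemma pres_classP t u : pres_class t = pres_class u <-> lie_eq rel t u.
Proof.
split=> [/eqmodP/asboolP //|tu]; apply/eqmodP; exact/asboolP.
Qed.

Lemma pres_class_surj (P : lie_pres -> Prop) :
  (forall t, P (pres_class t)) -> forall x, P x.
Proof. by move=> Pt; elim/quotW => t; exact: Pt. Qed.

Definition pres_repr (x : lie_pres) : lie_term K X :=
  repr (x : {eq_quot lie_equiv}).

Lemma pres_reprK x : pres_class (pres_repr x) = x.
Proof. exact: reprK. Qed.

Lemma pres_classK t : lie_eq rel (pres_repr (pres_class t)) t.
Proof. by apply/pres_classP; rewrite pres_reprK. Qed.

Definition pres_opp x := pres_class (LOpp (pres_repr x)).
Definition pres_add x y := pres_class (LAdd (pres_repr x) (pres_repr y)).
Definition pres_scale a x := pres_class (LScale a (pres_repr x)).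
Definition pres_br x y := pres_class (LBr (pres_repr x) (pres_repr y)).

Lemma pres_oppE t : pres_opp (pres_class t) = pres_class (LOpp t).
Proof. by apply/pres_classP/LE_opp/pres_classK. Qed.

Lemma pres_addE t u :
  pres_add (pres_class t) (pres_class u) = pres_class (LAdd t u).
Proof. by apply/pres_classP/LE_add; exact: pres_classK. Qed.

Lemma pres_scaleE a t :
  pres_scale a (pres_class t) = pres_class (LScale a t).
Proof. by apply/pres_classP/LE_scale/pres_classK. Qed.

Lemma pres_brE t u :
  pres_br (pres_class t) (pres_class u) = pres_class (LBr t u).
Proof. by apply/pres_classP/LE_br; exact: pres_classK. Qed.

Let presE := (pres_oppE, pres_addE, pres_scaleE, pres_brE).

Lemma pres_addA : associative pres_add.
Proof.
elim/pres_class_surj=> t; elim/pres_class_surj=> u; elim/pres_class_surj=> v.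
by rewrite !presE; apply/pres_classP/LE_addA.
Qed.

Lemma pres_addC : commutative pres_add.
Proof.
elim/pres_class_surj=> t; elim/pres_class_surj=> u.
by rewrite !presE; apply/pres_classP/LE_addC.
Qed.

Lemma pres_add0 : left_id (pres_class LZero) pres_add.
Proof.
by elim/pres_class_surj=> t; rewrite !presE; apply/pres_classP/LE_add0.
Qed.

Lemma pres_addN : left_inverse (pres_class LZero) pres_opp pres_add.
Proof.
by elim/pres_class_surj=> t; rewrite !presE; apply/pres_classP/LE_addN.
Qed.

HB.instance Definition _ := GRing.isZmodule.Build lie_pres
  pres_addA pres_addC pres_add0 pres_addN.

Lemma pres_scaleA a b x : pres_scale a (pres_scale b x) = pres_scale (a * b) x.
Proof.
by elim/pres_class_surj: x => t; rewrite !presE; apply/pres_classP/LE_scaleA.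
Qed.

Lemma pres_scale1 : left_id 1 pres_scale.
Proof.
by elim/pres_class_surj=> t; rewrite !presE; apply/pres_classP/LE_scale1.
Qed.

Lemma pres_scaleDr : right_distributive pres_scale +%R.
Proof.
move=> a; elim/pres_class_surj=> t; elim/pres_class_surj=> u.
rewrite /GRing.add /= !presE; exact/pres_classP/LE_scaleDr.
Qed.

Lemma pres_scaleDl x : {morph pres_scale^~ x : a b / a + b}.
Proof.
move=> a b; elim/pres_class_surj: x => t.
rewrite [in RHS]/GRing.add /= !presE; exact/pres_classP/LE_scaleDl.
Qed.

HB.instance Definition _ := GRing.Zmodule_isLmodule.Build K lie_pres
  pres_scaleA pres_scale1 pres_scaleDr pres_scaleDl.

Lemma pres_classZero : pres_class LZero = 0. Proof. by []. Qed.
Lemma pres_classOpp t : pres_class (LOpp t) = - pres_class t.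
Proof. by rewrite -pres_oppE. Qed.
Lemma pres_classAdd t u : pres_class (LAdd t u) = pres_class t + pres_class u.
Proof. by rewrite -pres_addE. Qed.
Lemma pres_classScale a t : pres_class (LScale a t) = a *: pres_class t.
Proof. by rewrite -pres_scaleE. Qed.

Lemma pres_br_bilinear : bilinear_for *:%R *:%R pres_br.
Proof.
split; elim/pres_class_surj=> v a; elim/pres_class_surj=> t;
  elim/pres_class_surj=> u;
  rewrite -pres_classScale -pres_classAdd /= !pres_brE;
  rewrite -pres_classScale -pres_classAdd; apply/pres_classP.
- exact: LE_brl.
- exact: LE_brr.
Qed.

Lemma pres_brxx x : pres_br x x = 0.
Proof.
elim/pres_class_surj: x => t.
by rewrite pres_brE -pres_classZero; apply/pres_classP/LE_brxx.
Qed.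

Lemma pres_br_jacobi x y z :
  pres_br x (pres_br y z) + pres_br y (pres_br z x) + pres_br z (pres_br x y)
  = 0.
Proof.
elim/pres_class_surj: x => t; elim/pres_class_surj: y => u.
elim/pres_class_surj: z => v.
rewrite !pres_brE -!pres_classAdd -pres_classZero.
exact/pres_classP/LE_jacobi.
Qed.

HB.instance Definition _ := Lmodule_isLieAlgebra.Build K lie_pres
  pres_br_bilinear pres_brxx pres_br_jacobi.

Lemma pres_classBr t u : pres_class (LBr t u) = lie (pres_class t) (pres_class u).
Proof. by rewrite -pres_brE. Qed.

Definition pres_gen (x : X) : lie_pres := pres_class (LGen x).

Fixpoint lie_eval (L : lieAlgType K) (f : X -> L) (t : lie_term K X) : L :=
  match t with
  | LGen x => f x
  | LZero => 0
  | LOpp t => - lie_eval f t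
  | LAdd t u => lie_eval f t + lie_eval f u
  | LScale a t => a *: lie_eval f t
  | LBr t u => lie (lie_eval f t) (lie_eval f u)
  end.

Lemma lie_eval_sound (L : lieAlgType K) (f : X -> L) :
  (forall t u, rel t u -> lie_eval f t = lie_eval f u) ->
  forall t u, lie_eq rel t u -> lie_eval f t = lie_eval f u.
Proof.
move=> frel t u; elim=> //=.
- by move=> {}t {}u v _ -> _ ->.
- by move=> {}t t' _ ->.
- by move=> {}t t' {}u u' _ -> _ ->.
- by move=> a {}t t' _ ->.
- by move=> {}t t' {}u u' _ -> _ ->.
- by move=> *; rewrite addrA.
- by move=> *; rewrite addrC.
- by move=> *; rewrite add0r.
- by move=> *; rewrite addNr.
- by move=> *; rewrite scalerA.
- by move=> *; rewrite scale1r.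
- by move=> *; rewrite scalerDr.
- by move=> *; rewrite scalerDl.
- by move=> *; rewrite lieDl lieZl.
- by move=> *; rewrite lieDr lieZr.
- by move=> *; rewrite liexx.
- by move=> *; rewrite lie_jacobi.
Qed.

Lemma pres_rel t u : rel t u -> pres_class t = pres_class u.
Proof. by move=> tu; apply/pres_classP/LE_rel. Qed.

Lemma lie_pres_universal (L : lieAlgType K) (f : X -> L) :
  (forall t u, rel t u -> lie_eval f t = lie_eval f u) ->
  exists! phi : lie_pres -> L,
    lie_hom phi /\ forall x, phi (pres_gen x) = f x.
Proof.
move=> frel; pose phi (x : lie_pres) := lie_eval f (pres_repr x).
have phiE t : phi (pres_class t) = lie_eval f t.
  exact/lie_eval_sound/pres_classK.
exists phi; split.
  split; last by move=> x; rewrite phiE.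
  split=> [a|]; elim/pres_class_surj=> t; elim/pres_class_surj=> u.
    by rewrite -pres_classScale -pres_classAdd !phiE.
  by rewrite -pres_classBr !phiE.
move=> psi [[psilin psibr] psigen]; apply/funext; elim/pres_class_surj=> t.
have psi0 : psi 0 = 0.
  have := psilin (- 1) 0 0; rewrite scaleN1r addNr => ->.
  by rewrite scaleN1r addNr.
have psiD x y : psi (x + y) = psi x + psi y.
  by have := psilin 1 x y; rewrite !scale1r.
have psiZ a x : psi (a *: x) = a *: psi x.
  by have := psilin a x 0; rewrite psi0 !addr0.
rewrite phiE; elim: t => [x||t IHt|t IHt u IHu|a t IHt|t IHt u IHu] /=.
- by rewrite -psigen.
- by rewrite pres_classZero psi0.
- by rewrite pres_classOpp -[in RHS]scaleN1r psiZ -IHt scaleN1r.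
- by rewrite pres_classAdd psiD -IHt -IHu.
- by rewrite pres_classScale psiZ -IHt.
- by rewrite pres_classBr psibr -IHt -IHu.
Qed.

End Presentation.

Section D.
Variable K : fieldType.

Definition Dterm : Type := lie_term K (int * int).
Definition dterm (alpha r : int) : Dterm := LGen (alpha, r).
Definition dterm_delta (i j : int) (t : Dterm) : Dterm :=
  LScale (i == j)%:R t.

Inductive D_rel : Dterm -> Dterm -> Prop :=
| D_rel_opp (alpha r : int) :
    D_rel (dterm (- alpha) r) (LOpp (dterm alpha r))
| D_rel_br (alpha beta r s : int) :
    D_rel (LBr (dterm alpha r) (dterm beta s))
      (LAdd (LAdd (LAdd
        (dterm_delta (alpha + beta) (s - r)
           (dterm (alpha + beta) (- alpha + s)))
        (LOpp (dterm_delta (alpha + beta) (r - s)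
           (dterm (alpha + beta) (alpha + s)))))
        (LOpp (dterm_delta (alpha - beta) (s - r)
           (dterm (alpha - beta) (- alpha + s)))))
        (dterm_delta (alpha - beta) (r - s)
           (dterm (alpha - beta) (alpha + s)))).

Definition frakD : lieAlgType K := lie_pres D_rel.

Definition dgen (alpha r : int) : frakD := pres_gen D_rel (alpha, r).

Lemma dgenN alpha r : dgen (- alpha) r = - dgen alpha r.
Proof.
by rewrite /dgen /pres_gen -pres_classOpp; exact/pres_rel/D_rel_opp.
Qed.

Lemma dgen_lie alpha beta r s :
  lie (dgen alpha r) (dgen beta s) =
    (alpha + beta == s - r)%:R *: dgen (alpha + beta) (- alpha + s)
    - (alpha + beta == r - s)%:R *: dgen (alpha + beta) (alpha + s)
    - (alpha - beta == s - r)%:R *: dgen (alpha - beta) (- alpha + s)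
    + (alpha - beta == r - s)%:R *: dgen (alpha - beta) (alpha + s).
Proof.
rewrite /dgen /pres_gen -pres_classBr (pres_rel (D_rel_br alpha beta r s)).
by rewrite !pres_classAdd !pres_classOpp !pres_classScale.
Qed.

End D.

Section GlInf.
Variable K : fieldType.
Local Notation zmat := (int -> int -> K^o).

Definition fin_mat : {pred zmat} :=
  fun A => `[< finite_set [set p : int * int | A p.1 p.2 != 0] >].

Lemma fin_mat_closed : submod_closed fin_mat.
Proof.
split.
  apply/asboolP; rewrite [X in finite_set X](_ : _ = set0) //.
  by apply/seteqP; split=> // p /=; rewrite eqxx.
move=> a A B /asboolP Afin /asboolP Bfin; apply/asboolP.
have ABfin : finite_set ([set p : int * int | A p.1 p.2 != 0] `|`
                         [set p : int * int | B p.1 p.2 != 0]).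
  by rewrite finite_setU.
apply: (sub_finite_set _ ABfin) => p /=.
have [A0|] := eqVneq (A p.1 p.2) 0; last by left.
have [B0|] := eqVneq (B p.1 p.2) 0; last by right.
by rewrite !fctE A0 B0 scaler0 addr0 eqxx.
Qed.

HB.instance Definition _ :=
  GRing.isSubmodClosed.Build K zmat fin_mat fin_mat_closed.

Definition gl_inf : Type := {A : zmat | A \in fin_mat}.
HB.instance Definition _ := SubType.copy gl_inf {A : zmat | A \in fin_mat}.
HB.instance Definition _ := [Choice of gl_inf by <:].
HB.instance Definition _ := [SubChoice_isSubLmodule of gl_inf by <:].

Definition entry (A : gl_inf) : int -> int -> K := val A.

Lemma gl_ext (A B : gl_inf) : entry A =2 entry B -> A = B.
Proof. by move=> AB; apply/val_inj/funext=> m; apply/funext=> n; exact: AB. Qed.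

Lemma entry0 m n : entry 0 m n = 0. Proof. by []. Qed.
Lemma entryD A B m n : entry (A + B) m n = entry A m n + entry B m n.
Proof. by []. Qed.
Lemma entryN A m n : entry (- A) m n = - entry A m n. Proof. by []. Qed.
Lemma entryZ a A m n : entry (a *: A) m n = a * entry A m n.
Proof. by []. Qed.

Definition mat_mul (A B : int -> int -> K) : int -> int -> K :=
  fun m n => \sum_(k \in [set: int]) A m k * B k n.

Definition mat_br (A B : int -> int -> K) : zmat :=
  fun m n => mat_mul A B m n - mat_mul B A m n.

Definition bounded_by (s : seq int) (A : int -> int -> K) :=
  forall m n, A m n != 0 -> (m \in s) && (n \in s).

Lemma gl_bounded (A : gl_inf) : exists s, bounded_by s (entry A).
Proof.
have /asboolP/finite_seqP[s sE] := valP A.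
exists (map fst s ++ map snd s) => m n Amn.
have : [set p : int * int | val A p.1 p.2 != 0] (m, n) by [].
rewrite sE /= => mns; rewrite !mem_cat.
by rewrite (map_f fst mns) (map_f snd mns) orbT.
Qed.

Lemma bounded_gl s (A : zmat) : bounded_by s A -> A \in fin_mat.
Proof.
move=> sA; apply/asboolP.
apply: (@sub_finite_set _ _ [set` [seq (m, n) | m <- s, n <- s]]).
  by move=> [m n] /= /sA/andP[ms ns]; exact: allpairs_f.
exact: finite_seq.
Qed.

Lemma bounded_undup s A : bounded_by s A -> bounded_by (undup s) A.
Proof. by move=> sA m n /sA; rewrite !mem_undup. Qed.

Lemma bounded_catl s s' A : bounded_by s A -> bounded_by (s ++ s') A.
Proof. by move=> sA m n /sA/andP[ms ns]; rewrite !mem_cat ms ns. Qed.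

Lemma bounded_catr s s' A : bounded_by s' A -> bounded_by (s ++ s') A.
Proof. by move=> sA m n /sA/andP[ms ns]; rewrite !mem_cat ms ns !orbT. Qed.

Lemma gl_bounded3 (A B C : gl_inf) : exists2 s, uniq s &
  [/\ bounded_by s (entry A), bounded_by s (entry B) & bounded_by s (entry C)].
Proof.
have [[[a aA] [b bB]] [c cC]] := (gl_bounded A, gl_bounded B, gl_bounded C).
exists (undup ((a ++ b) ++ c)); first exact: undup_uniq.
split; apply: bounded_undup.
- exact/bounded_catl/bounded_catl.
- exact/bounded_catl/bounded_catr.
- exact: bounded_catr.
Qed.

Lemma mat_mulE s A B m n : uniq s -> bounded_by s A \/ bounded_by s B ->
  mat_mul A B m n = \sum_(k <- s) A m k * B k n.
Proof.
move=> us sAB; rewrite /mat_mul (fsbig_seq _ _ us).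
apply/esym/fsbig_widen; first by [].
move=> k [_ ks]; apply/eqP/negPn/negP.
rewrite mulf_eq0 negb_or => /andP[Amk Bkn]; apply: ks => /=.
by case: sAB => [/(_ _ _ Amk)/andP[]|/(_ _ _ Bkn)/andP[]].
Qed.

Lemma bounded_mul s A B : uniq s -> bounded_by s A -> bounded_by s B ->
  bounded_by s (mat_mul A B).
Proof.
move=> us sA sB m n; rewrite (mat_mulE m n us (or_introl sA)).
apply: contra_neqT => mn; apply: big1 => k _; apply/eqP.
rewrite mulf_eq0; apply: contraNT mn; rewrite negb_or.
by move=> /andP[/sA/andP[-> _] /sB/andP[_ ->]].
Qed.

Lemma bounded_br s A B : uniq s -> bounded_by s A -> bounded_by s B ->
  bounded_by s (mat_br A B).
Proof.
move=> us sA sB m n ABmn.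
have [ABm|] := eqVneq (mat_mul A B m n) 0; last exact: bounded_mul.
apply: (@bounded_mul s B A) => //; move: ABmn.
by rewrite /mat_br ABm sub0r oppr_eq0.
Qed.

Lemma mat_br_fin (A B : gl_inf) : mat_br (entry A) (entry B) \in fin_mat.
Proof.
have [s us [sA sB _]] := gl_bounded3 A B 0.
exact/bounded_gl/(bounded_br us sA sB).
Qed.

Definition gl_br (A B : gl_inf) : gl_inf :=
  Sub (mat_br (entry A) (entry B)) (mat_br_fin A B).

Lemma gl_brE A B m n : entry (gl_br A B) m n =
  mat_mul (entry A) (entry B) m n - mat_mul (entry B) (entry A) m n.
Proof. by []. Qed.

Lemma gl_brxx A : gl_br A A = 0.
Proof. by apply: gl_ext => m n; rewrite gl_brE subrr. Qed.

Lemma gl_brC A B : gl_br A B = - gl_br B A.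
Proof. by apply: gl_ext => m n; rewrite entryN !gl_brE opprB. Qed.

Lemma gl_br_linl (C : gl_inf) : linear (gl_br^~ C).
Proof.
move=> a A B; apply: gl_ext => m n.
have [s us [sA sB sC]] := gl_bounded3 A B C.
rewrite /= entryD entryZ !gl_brE.
rewrite !(mat_mulE m n us (or_introl sC)) !(mat_mulE m n us (or_intror sC)).
rewrite -!sumrB mulr_sumr -big_split /=; apply: eq_bigr => k _.
rewrite !entryD !entryZ; ring.
Qed.

Lemma gl_br_bilinear : bilinear_for *:%R *:%R gl_br.
Proof.
split; first exact: gl_br_linl.
move=> C a A B /=; rewrite !(gl_brC C) gl_br_linl /=.
by rewrite opprD scalerN.
Qed.

Lemma mat_mulA s A B C : uniq s ->
  bounded_by s A -> bounded_by s B -> bounded_by s C ->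
  mat_mul A (mat_mul B C) =2 mat_mul (mat_mul A B) C.
Proof.
move=> us sA sB sC m n.
rewrite (mat_mulE m n us (or_introl sA)) (mat_mulE m n us (or_intror sC)).
under eq_bigr do rewrite (mat_mulE _ _ us (or_introl sB)) mulr_sumr.
rewrite exchange_big /=; apply: eq_bigr => k _.
rewrite (mat_mulE _ _ us (or_introl sA)) mulr_suml.
by apply: eq_bigr => l _; rewrite mulrA.
Qed.

Lemma mat_mulBr s A B C m n : uniq s -> bounded_by s A ->
  mat_mul A (mat_br B C) m n =
  mat_mul A (mat_mul B C) m n - mat_mul A (mat_mul C B) m n.
Proof.
move=> us sA; rewrite !(mat_mulE m n us (or_introl sA)) -sumrB.
by apply: eq_bigr => k _; rewrite -mulrBr.
Qed.

Lemma mat_mulBl s A B C m n : uniq s -> bounded_by s A ->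
  mat_mul (mat_br B C) A m n =
  mat_mul (mat_mul B C) A m n - mat_mul (mat_mul C B) A m n.
Proof.
move=> us sA; rewrite !(mat_mulE m n us (or_intror sA)) -sumrB.
by apply: eq_bigr => k _; rewrite -mulrBl.
Qed.

Lemma gl_br_jacobi A B C :
  gl_br A (gl_br B C) + gl_br B (gl_br C A) + gl_br C (gl_br A B) = 0.
Proof.
apply: gl_ext => m n; have [s us [sA sB sC]] := gl_bounded3 A B C.
rewrite !entryD entry0 !gl_brE.
rewrite -[entry (gl_br B C)]/(mat_br (entry B) (entry C)).
rewrite -[entry (gl_br C A)]/(mat_br (entry C) (entry A)).
rewrite -[entry (gl_br A B)]/(mat_br (entry A) (entry B)).
rewrite (mat_mulBr _ _ _ _ us sA) (mat_mulBr _ _ _ _ us sB).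
rewrite (mat_mulBr _ _ _ _ us sC) (mat_mulBl _ _ _ _ us sA).
rewrite (mat_mulBl _ _ _ _ us sB) (mat_mulBl _ _ _ _ us sC).
rewrite !(mat_mulA us) //.
ring.
Qed.

HB.instance Definition _ := Lmodule_isLieAlgebra.Build K gl_inf
  gl_br_bilinear gl_brxx gl_br_jacobi.

Lemma entry_lie (A B : gl_inf) m n : entry (lie A B) m n =
  mat_mul (entry A) (entry B) m n - mat_mul (entry B) (entry A) m n.
Proof. by []. Qed.

Definition unit_mat (m n : int) : zmat :=
  fun i j => ((i == m) && (j == n))%:R.

Lemma unit_mat_bounded m n : bounded_by [:: m; n] (unit_mat m n).
Proof.
move=> i j; rewrite /unit_mat !inE.
by case: (i =P m); case: (j =P n); rewrite ?eqxx ?orbT.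
Qed.

Definition munit (m n : int) : gl_inf :=
  Sub (unit_mat m n) (bounded_gl (@unit_mat_bounded m n)).

Lemma entry_munit m n i j : entry (munit m n) i j = ((i == m) && (j == n))%:R.
Proof. by []. Qed.

Lemma mat_mul_unit m n k l i j :
  mat_mul (unit_mat m n) (unit_mat k l) i j = (n == k)%:R * unit_mat m l i j.
Proof.
rewrite (@mat_mulE (undup [:: m; n]) _ _ _ _ (undup_uniq _)); last first.
  by left; exact/bounded_undup/unit_mat_bounded.
rewrite (bigD1_seq n) ?undup_uniq ?mem_undup ?inE ?eqxx ?orbT //=.
rewrite big1 ?addr0 => [|t /negPf tn]; last first.
  by rewrite /unit_mat tn andbF mul0r.
rewrite /unit_mat eqxx andbT.
by case: (i == m); case: (n == k); case: (j == l); rewrite ?mulr0 ?mulr1.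
Qed.

Lemma lie_munit m n k l :
  lie (munit m n) (munit k l) = (n == k)%:R *: munit m l - (l == m)%:R *: munit k n.
Proof.
apply: gl_ext => i j; rewrite entryD entryN !entryZ entry_lie.
by rewrite !mat_mul_unit.
Qed.

Definition even_units : set gl_inf :=
  [set X | exists m n : int, (2 %| m + n)%Z /\ X = munit m n].

Lemma even_units_lie (X Y : gl_inf) : even_units X -> even_units Y ->
  lin_span even_units (lie X Y).
Proof.
move=> [m [n [mn ->]]] [k [l [kl ->]]]; rewrite lie_munit.
have unitP (b : bool) (p q : int) : (b -> 2 %| p + q)%Z ->
    lin_span even_units (b%:R *: munit p q).
  case: b => [/(_ isT) pq|_]; last by rewrite scale0r; exact: lin_span0.
  by apply/lin_spanZ/lin_span_gen; exists p, q.
rewrite -scaleN1r; apply: lin_spanD; last apply: lin_spanZ; apply: unitP.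
  move=> /eqP nk; rewrite (_ : m + l = (m + n) + (k + l) - n * 2); last first.
    by rewrite nk; ring.
  by apply: rpredB; [exact: rpredD | exact: dvdz_mull].
move=> /eqP lm; rewrite (_ : k + n = (m + n) + (k + l) - m * 2); last first.
  by rewrite lm; ring.
by apply: rpredB; [exact: rpredD | exact: dvdz_mull].
Qed.

Definition calA : lieSubalg gl_inf :=
  LieSubalg (lin_span0 even_units) (@lin_span_lin _ _ even_units)
    (lin_span_lie even_units_lie).

(* Negative transpose: the linear extension of E_(m,n) |-> - E_(n,m), see
   tau_munit. *)
Definition tau_mat (A : int -> int -> K) : zmat := fun m n => - A n m.

Lemma tau_mat_fin (A : gl_inf) : tau_mat (entry A) \in fin_mat.
Proof.
have [s sA] := gl_bounded A; apply: (@bounded_gl s) => m n.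
by rewrite /tau_mat oppr_eq0 => /sA; rewrite andbC.
Qed.

Definition tau (A : gl_inf) : gl_inf :=
  Sub (tau_mat (entry A)) (tau_mat_fin A).

Lemma entry_tau A m n : entry (tau A) m n = - entry A n m.
Proof. by []. Qed.

Lemma tau_munit m n : tau (munit m n) = - munit n m.
Proof. by apply: gl_ext => i j; rewrite entry_tau entryN !entry_munit andbC. Qed.

Lemma tauK : involutive tau.
Proof. by move=> A; apply: gl_ext => m n; rewrite !entry_tau opprK. Qed.

Lemma tau_linear : linear tau.
Proof.
move=> a A B; apply: gl_ext => m n.
by rewrite entryD entryZ !entry_tau entryD entryZ; ring.
Qed.

Lemma tau_lie A B : tau (lie A B) = lie (tau A) (tau B).
Proof.
apply: gl_ext => m n; rewrite entry_tau !entry_lie opprB.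
by congr (_ - _); apply: eq_fsbigr => k _; rewrite !entry_tau; ring.
Qed.

Lemma tau_iso : lie_iso tau.
Proof.
by split; [split; [exact: tau_linear | exact: tau_lie] | exists tau; exact: tauK].
Qed.

Definition Atau_set : set gl_inf := [set X | subalg_set calA X /\ tau X = X].

Lemma Atau0 : Atau_set 0.
Proof.
split; first exact: subalg0.
by apply: gl_ext => m n; rewrite entry_tau entry0 oppr0.
Qed.

Lemma Atau_lin a u v : Atau_set u -> Atau_set v -> Atau_set (a *: u + v).
Proof.
move=> [Au tu] [Av tv]; split; first exact: subalg_lin.
by rewrite tau_linear tu tv.
Qed.

Lemma Atau_lie u v : Atau_set u -> Atau_set v -> Atau_set (lie u v).
Proof.
move=> [Au tu] [Av tv]; split; first exact: subalg_lie.
by rewrite tau_lie tu tv.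
Qed.

Definition Atau_subalg : lieSubalg gl_inf := LieSubalg Atau0 Atau_lin Atau_lie.

Definition Atau : lieAlgType K := subalg_type Atau_subalg.

Definition Gtau_mat (alpha m : int) : gl_inf :=
  munit (m + alpha) (m - alpha) - munit (m - alpha) (m + alpha).

Lemma Gtau_subproof alpha m : subalg_set Atau_subalg (Gtau_mat alpha m).
Proof.
have ab : (2 %| (m - alpha) + (m + alpha))%Z.
  by rewrite (_ : _ + _ = m * 2) ?dvdz_mull //; ring.
rewrite /Gtau_mat; move: ab; set a := m + alpha; set b := m - alpha => ab.
have -> : munit a b - munit b a = -1 *: munit b a + munit a b by rewrite scaleN1r addrC.
split; last by rewrite tau_linear !tau_munit scalerN !scaleN1r opprK addrC.
apply: subalg_lin; apply: lin_span_gen; first by exists b, a.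
by exists a, b; rewrite addrC.
Qed.

Definition Gtau (alpha m : int) : Atau := to_subalg (Gtau_subproof alpha m).

End GlInf.

(* Main.v *)
Require Import Defs.
From mathcomp Require Import all_boot all_order all_algebra.
From mathcomp Require Import complex ring zify.
From mathcomp Require Import boolp classical_sets functions fsbigop reals.
Set Implicit Arguments.
Unset Strict Implicit.
Unset Printing Implicit Defensive.

Import Order.TTheory GRing.Theory Num.Theory.
Local Open Scope ring_scope.
Local Open Scope classical_set_scope.

(** By universality there is a Lie morphism [phi] sending [d^(alpha,r)] to
    [G_(-alpha,r)].  The bracket relations and [d^(-alpha,r) = - d^(alpha,r)]
    show that the [d^(alpha,r)] with [alpha >= 1] span, and the coefficient of
    [d^(alpha,r)] in [x] is the entry of [phi x] at [(r - alpha, r + alpha)];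
    this gives the basis and the injectivity of [phi].  Surjectivity is the
    averaging [A = (A + tau A) / 2].  The form is [- tr (phi x * phi y) / 2], so
    that its symmetry and invariance are those of the trace form. *)

(** * Spans, coordinates and spanning sets of presented Lie algebras *)

Lemma lin_span_ind (K : fieldType) (V : lmodType K) (X P : set V) :
  P 0 -> (forall a u v, X u -> P v -> P (a *: u + v)) -> lin_span X `<=` P.
Proof.
move=> P0 Plin _ [n [a [x [Xx ->]]]].
elim/big_rec: _ => // i v _; exact: Plin.
Qed.

(** Repeated indices are merged by adding their coefficients, which yields the duplicate-free list
    that [dual_coef] requires. *)
Lemma lin_span_uniq (K : fieldType) (V : lmodType K) (I : choiceType)
    (P : set I) (v : I -> V) x :
  lin_span (v @` P) x -> exists s (a : I -> K),
    [/\ uniq s, forall i, i \in s -> P i & x = \sum_(i <- s) a i *: v i].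
Proof.
move=> [n [a [y [yP ->]]]].
have /boolp.choice[p pP] j : exists i, P i /\ v i = y j.
  by have [i Pi vi] := yP j; exists i.
exists (undup (codom p)), (fun i => \sum_(j | p j == i) a j).
split; first exact: undup_uniq.
  by move=> i; rewrite mem_undup => /codomP[j ->]; have [] := pP j.
under [RHS]eq_bigr do rewrite scaler_suml.
rewrite (exchange_big_dep xpredT) //=; apply: eq_bigr => j _.
(* For fixed [j], only the index [p j] contributes to the inner sum. *)
rewrite (big_rem (p j)) ?mem_undup ?codom_f //= eqxx.
rewrite big_seq_cond big1 ?addr0 => [|i /andP[]]; first by have [_ ->] := pP j.
by rewrite mem_rem_uniq ?undup_uniq // inE => /andP[/negPf + _] /eqP pji;
  rewrite pji eqxx.
Qed.

(** Dual functionals read off coefficients; this serves both linear independence and the injectivity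
    of [phi]. *)
Lemma dual_coef (K : fieldType) (V : lmodType K) (I : choiceType) (P : set I)
    (v : I -> V) (f : I -> V -> K) s (a : I -> K) :
  (forall i, linear_for *%R (f i)) ->
  (forall i j, P i -> P j -> f i (v j) = (i == j)%:R) ->
  uniq s -> (forall i, i \in s -> P i) ->
  forall i, i \in s -> f i (\sum_(j <- s) a j *: v j) = a i.
Proof.
move=> flin fv us sP i si.
have f0 : f i 0 = 0.
  by have := flin i (- 1) 0 0; rewrite scaleN1r addNr mulN1r addNr.
have fD x y : f i (x + y) = f i x + f i y.
  by have := flin i 1 x y; rewrite scale1r mul1r.
have fZ b x : f i (b *: x) = b * f i x.
  by have := flin i b x 0; rewrite f0 !addr0.
rewrite (big_morph (f i) fD f0) (bigD1_seq i) //= fZ fv ?eqxx ?mulr1; auto.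
rewrite big_seq_cond big1 ?addr0 // => j /andP[sj /negPf ji].
by rewrite fZ fv ?(eq_sym i) ?ji ?mulr0; auto.
Qed.

(** Every element is the class of a term, and induction on terms applies because the span is closed
    under each term constructor. *)
Lemma lie_pres_span (K : fieldType) (T : Type)
    (rel : lie_term K T -> lie_term K T -> Prop) (X : set (lie_pres rel)) :
  (forall t, lin_span X (pres_gen rel t)) ->
  (forall x y, X x -> X y -> lin_span X (lie x y)) ->
  lin_span X = [set: lie_pres rel].
Proof.
move=> Xgen Xlie; apply/seteqP; split=> // x _.
elim/pres_class_surj: x; elim=> [t||t IHt|t IHt u IHu|a t IHt|t IHt u IHu].
- exact: Xgen.
- exact: lin_span0.
- by rewrite pres_classOpp -scaleN1r; exact: lin_spanZ.
- by rewrite pres_classAdd; exact: lin_spanD.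
- by rewrite pres_classScale; exact: lin_spanZ.
- by rewrite pres_classBr; exact: lin_span_lie.
Qed.

(** * The trace form on finitely supported matrices *)

Section TraceForm.
Variable K : fieldType.
Implicit Types A B C : gl_inf K.

Definition trace_form A B : K :=
  \sum_(k \in [set: int]) mat_mul (entry A) (entry B) k k.

Lemma trace_formE s A B : uniq s ->
  bounded_by s (entry A) -> bounded_by s (entry B) ->
  trace_form A B = \sum_(k <- s) \sum_(l <- s) entry A k l * entry B l k.
Proof.
move=> us sA sB; rewrite /trace_form.
transitivity (\sum_(k <- s) mat_mul (entry A) (entry B) k k).
  rewrite (fsbig_seq _ _ us); apply/esym/fsbig_widen; first by [].
  move=> k [_ ks]; apply/eqP/negPn/negP => ABk; apply: ks => /=.
  by have /andP[] := bounded_mul us sA sB ABk.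
by apply: eq_bigr => k _; exact/mat_mulE/or_introl.
Qed.

Lemma trace_formC A B : trace_form A B = trace_form B A.
Proof.
have [s us [sA sB _]] := gl_bounded3 A B 0.
rewrite !(trace_formE us) // exchange_big /=.
by apply: eq_bigr => k _; apply: eq_bigr => l _; rewrite mulrC.
Qed.

Lemma trace_form_linl B : linear_for *%R (trace_form^~ B).
Proof.
move=> a A C; have [s us [sA sB sC]] := gl_bounded3 A B C.
have sAC : bounded_by s (entry (a *: A + C)).
  move=> m n; rewrite entryD entryZ => ACmn.
  have [Amn|] := eqVneq (entry A m n) 0; last exact: sA.
  by apply: sC; move: ACmn; rewrite Amn mulr0 add0r.
rewrite !(trace_formE us) // mulr_sumr -big_split; apply: eq_bigr => k _ /=.
rewrite mulr_sumr -big_split; apply: eq_bigr => l _ /=.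
by rewrite entryD entryZ; ring.
Qed.

(** This reduces the values of the form on generators to comparisons of indices. *)
Lemma trace_form_munit m n B : trace_form (munit K m n) B = entry B n m.
Proof.
have [s us [sE sB _]] := gl_bounded3 (munit K m n) B 0.
have /andP[ms ns] : (m \in s) && (n \in s).
  by apply: sE; rewrite entry_munit !eqxx oner_eq0.
rewrite (trace_formE us) // (bigD1_seq m) //= (bigD1_seq n) //=.
rewrite entry_munit !eqxx mul1r !big1 ?addr0 // => [k|l] /negPf nk.
  by rewrite big1 // => l _; rewrite entry_munit nk mul0r.
by rewrite entry_munit nk andbF mul0r.
Qed.

(** With [T X Y Z] the trace of the product [XYZ], the two sides are [T A B C - T B A C] and
    [T A B C - T A C B]; they agree because the trace is cyclic. *)
Lemma trace_form_invariant : form_invariant trace_form.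
Proof.
move=> A B C; have [s us [sA sB sC]] := gl_bounded3 A B C.
have sAB : bounded_by s (entry (lie A B)) by exact: bounded_br.
have sBC : bounded_by s (entry (lie B C)) by exact: bounded_br.
pose T (X Y Z : gl_inf K) := \sum_(k <- s) \sum_(l <- s) \sum_(p <- s)
  entry X k l * entry Y l p * entry Z p k.
have cyc X Y Z : T X Y Z = T Y Z X.
  rewrite /T exchange_big; apply: eq_bigr => l _ /=.
  rewrite exchange_big; apply: eq_bigr => p _ /=.
  by apply: eq_bigr => k _; ring.
have -> : trace_form (lie A B) C = T A B C - T B A C.
  rewrite (trace_formE us) // -sumrB; apply: eq_bigr => k _.
  rewrite [X in X - _]exchange_big [X in _ - X]exchange_big -sumrB.
  apply: eq_bigr => p _ /=; rewrite entry_lie.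
  rewrite (mat_mulE _ _ us (or_introl sA)) (mat_mulE _ _ us (or_introl sB)).
  by rewrite mulrBl !mulr_suml.
rewrite (cyc B); have -> : trace_form A (lie B C) = T A B C - T A C B.
  rewrite (trace_formE us) // -sumrB; apply: eq_bigr => k _.
  rewrite -sumrB; apply: eq_bigr => l _ /=; rewrite entry_lie.
  rewrite (mat_mulE _ _ us (or_introl sB)) (mat_mulE _ _ us (or_introl sC)).
  rewrite mulrBr !mulr_sumr.
  by congr (_ - _); apply: eq_bigr => p _; rewrite mulrA.
by [].
Qed.

End TraceForm.

(** * Bracket relations among the matrices [Gtau], and the induced morphism *)

Section DAtau.
Variable K : fieldType.
Local Notation dgen := (dgen K).
Local Notation posD := ((fun p : int * int => dgen p.1 p.2) @`
  [set p : int * int | 1 <= p.1]).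

Lemma val_Gtau alpha r : val (Gtau K alpha r) =
  munit K (r + alpha) (r - alpha) - munit K (r - alpha) (r + alpha).
Proof. by []. Qed.

Lemma GtauN alpha r : Gtau K (- alpha) r = - Gtau K alpha r.
Proof. by apply: val_inj; rewrite val_subalgN !val_Gtau opprK opprB. Qed.

(** The two factors are [E_(a,b) - E_(b,a)] and [E_(c,d) - E_(d,c)]. Their bracket has eight terms,
    two for each of the coincidences [b = c], [d = a], [b = d], [c = a], and each such pair is a
    multiple of one [Gtau]. *)
Lemma lie_Gtau alpha beta r s :
  lie (Gtau K (- alpha) r) (Gtau K (- beta) s) =
    (alpha + beta == s - r)%:R *: Gtau K (- (alpha + beta)) (- alpha + s)
    - (alpha + beta == r - s)%:R *: Gtau K (- (alpha + beta)) (alpha + s)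
    - (alpha - beta == s - r)%:R *: Gtau K (- (alpha - beta)) (- alpha + s)
    + (alpha - beta == r - s)%:R *: Gtau K (- (alpha - beta)) (alpha + s).
Proof.
(* The indices on the two sides agree only when the Kronecker condition [e] holds; otherwise both
   sides vanish. *)
have deltaG (e : bool) g m p q : (e -> (m - g == p) && (m + g == q)) ->
    e%:R *: (munit K (m - g) (m + g) - munit K (m + g) (m - g)) =
    e%:R *: (munit K p q - munit K q p).
  by case: e => [/(_ isT)/andP[/eqP-> /eqP->]|_] //; rewrite !scale0r.
apply: val_inj; rewrite !(val_subalgD, val_subalgN, val_subalgZ).
rewrite val_sublie !val_Gtau !opprK.
rewrite !(lieDl, lieDr, lieNl, lieNr) !lie_munit.
set a := r - alpha; set b := r + alpha; set c := s - beta; set d := s + beta.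
rewrite (_ : (alpha + beta == s - r) = (b == c)); last by lia.
rewrite (_ : (alpha + beta == r - s) = (d == a)); last by lia.
rewrite (_ : (alpha - beta == s - r) = (b == d)); last by lia.
rewrite (_ : (alpha - beta == r - s) = (c == a)); last by lia.
rewrite (deltaG _ (alpha + beta) (- alpha + s) a d); last by lia.
rewrite (deltaG _ (alpha + beta) (alpha + s) c b); last by lia.
rewrite (deltaG _ (alpha - beta) (- alpha + s) a c); last by lia.
rewrite (deltaG _ (alpha - beta) (alpha + s) d b); last by lia.
rewrite (eq_sym c b) (eq_sym d b) (eq_sym a c) (eq_sym a d).
apply: gl_ext => i j; rewrite !(entryD, entryN, entryZ); ring.
Qed.

Lemma frakD_to_Atau : exists phi : frakD K -> Atau K,
  lie_hom phi /\ forall alpha r, phi (dgen alpha r) = Gtau K (- alpha) r.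
Proof.
have [|phi [[phiL phiG] _]] := @lie_pres_universal K _ (@D_rel K) (Atau K)
    (fun p => Gtau K (- p.1) p.2).
  move=> _ _ [alpha r|alpha beta r s] /=; first by rewrite GtauN.
  exact: lie_Gtau.
by exists phi; split=> // alpha r; rewrite phiG.
Qed.

(** * Spanning by the generators of positive first index *)

Hypothesis two_neq0 : 2%:R != 0 :> K.

Lemma dgen0 r : dgen 0 r = 0.
Proof.
have d0N : dgen 0 r = - dgen 0 r by rewrite -dgenN oppr0.
apply/eqP; have : 2%:R *: dgen 0 r == 0.
  by rewrite scaler_nat mulr2n {1}d0N addNr.
by rewrite scaler_eq0 (negPf two_neq0).
Qed.

Lemma dgen_posD alpha r : lin_span posD (dgen alpha r).
Proof.
have pos b : 1 <= b -> lin_span posD (dgen b r).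
  by move=> b1; apply: lin_span_gen; exists (b, r).
have [a0|a0|->] := ltrgtP alpha 0.
- by rewrite -[alpha]opprK dgenN -scaleN1r; apply/lin_spanZ/pos; lia.
- by apply: pos; lia.
- by rewrite dgen0; exact: lin_span0.
Qed.

(** A bracket of generators is a combination of generators whose first index may have any sign;
    [dgen_posD] brings these back to positive index. *)
Lemma frakD_span : lin_span posD = [set: frakD K].
Proof.
apply: lie_pres_span => [[alpha r]|_ _ [[a r] /= _ <-] [[b s] /= _ <-]].
  exact: dgen_posD.
rewrite dgen_lie -!scaleN1r.
by do !apply: lin_spanD; do !apply: lin_spanZ; exact: dgen_posD.
Qed.

(** * Coordinates, basis and bijectivity *)

Section Iso.
Variable phi : frakD K -> Atau K.
Hypothesis phi_hom : lie_hom phi.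
Hypothesis phi_dgen : forall alpha r, phi (dgen alpha r) = Gtau K (- alpha) r.

Let phi_lin : linear phi := phi_hom.1.

Let phi0 : phi 0 = 0.
Proof. by have := phi_lin (- 1) 0 0; rewrite scaleN1r addNr scaleN1r addNr. Qed.

Definition dcoef (p : int * int) (x : frakD K) : K :=
  entry (val (phi x)) (p.2 - p.1) (p.2 + p.1).

Lemma dcoef_linear p : linear_for *%R (dcoef p).
Proof.
by move=> a x y; rewrite /dcoef phi_lin val_subalgD val_subalgZ entryD entryZ.
Qed.

Lemma dcoef_dgen (p q : int * int) : 1 <= p.1 -> 1 <= q.1 ->
  dcoef p (dgen q.1 q.2) = (p == q)%:R.
Proof.
case: p q => [a r] [b s] /= a1 b1.
rewrite /dcoef phi_dgen val_Gtau entryD entryN !entry_munit /=.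
(* As [a] and [b] are positive, the entry read lies strictly above the diagonal and the second
   matrix unit strictly below it. *)
rewrite opprK (_ : (r - a == s + b) && (r + a == s - b) = false); last by lia.
rewrite subr0.
by rewrite xpair_eqE; congr (_%:R); lia.
Qed.

Lemma frakD_coef s (a : int * int -> K) : uniq s ->
  (forall p, p \in s -> 1 <= p.1) -> forall p, p \in s ->
  dcoef p (\sum_(q <- s) a q *: dgen q.1 q.2) = a p.
Proof.
move=> us sP.
exact: (@dual_coef _ _ _ [set p | 1 <= p.1] (fun p => dgen p.1 p.2) dcoef s a
  dcoef_linear dcoef_dgen us sP).
Qed.

Lemma frakD_basis : basis_of_family [set p : int * int | 1 <= p.1]
  (fun p => dgen p.1 p.2).
Proof.
split; last exact: frakD_span.
move=> s a us sP sum0 p sp.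
by rewrite -(frakD_coef a us sP sp) sum0 /dcoef phi0.
Qed.

Lemma phi_inj : injective phi.
Proof.
move=> x y phixy; apply/eqP; rewrite -subr_eq0; apply/eqP.
have phiB : phi (x - y) = 0.
  by rewrite -scaleN1r addrC phi_lin phixy scaleN1r addNr.
have : lin_span posD (x - y) by rewrite frakD_span.
move=> /lin_span_uniq[s [a [us sP xyE]]].
rewrite xyE big_seq big1 // => p sp.
by rewrite -(frakD_coef a us sP sp) -xyE /dcoef phiB entry0 scale0r.
Qed.

Lemma phi_surj (A : Atau K) : exists x, phi x = A.
Proof.
have [AA tauA] := subalg_typeP A.
(* Proved for every matrix of [calA], since the matrix units that span it need not be fixed by
   [tau]. *)
have [x phix] : exists x, val (phi x) = val A + tau (val A).
  have P0 : exists x, val (phi x) = 0 + tau 0 :> gl_inf K.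
    exists 0; rewrite phi0 add0r.
    by apply: gl_ext => m n; rewrite entry_tau entry0 oppr0.
  move: AA; apply: (@lin_span_ind _ _ _
    [set B | exists x, val (phi x) = B + tau B] P0) => a E B.
  move=> [m [n [mn ->]]] [x xB].
  (* Parity gives the midpoint [q] of [m] and [n], and [phi] sends [dgen (q - m) q] to
     [E_(m,n) - E_(n,m)]. *)
  have [q mnq] : exists q : int, m + n = q * 2 by exact/dvdzP.
  exists (a *: dgen (q - m) q + x).
  rewrite phi_lin val_subalgD val_subalgZ phi_dgen xB val_Gtau tau_linear.
  rewrite (_ : q + _ = m); last by lia.
  rewrite (_ : q - _ = n); last by lia.
  by rewrite tau_munit scalerDr addrACA.
(* The summand [0] only gives the witness the shape that [phi_lin] rewrites. *)
exists (2%:R^-1 *: x + 0); apply: val_inj.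
rewrite phi_lin val_subalgD val_subalgZ phix tauA -mulr2n -scaler_nat scalerA.
by rewrite mulVf // scale1r phi0 addr0.
Qed.

Lemma phi_iso : lie_iso phi.
Proof.
split=> //; rewrite -setTT_bijective; split=> //.
  by move=> x y _ _; exact: phi_inj.
by move=> A _; have [x] := phi_surj A; exists x.
Qed.

(** * The invariant form and its uniqueness *)

Definition Dform (x y : frakD K) : K :=
  - 2%:R^-1 * trace_form (val (phi x)) (val (phi y)).

Lemma Dform_sym : form_symmetric Dform.
Proof. by move=> x y; rewrite /Dform trace_formC. Qed.

Lemma Dform_invariant : form_invariant Dform.
Proof.
by move=> x y z; rewrite /Dform !phi_hom.2 !val_sublie trace_form_invariant.
Qed.

Lemma Dform_bilinear : bilinear_for *%R *%R Dform.
Proof.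
have linl y : linear_for *%R (Dform^~ y).
  move=> a x z; rewrite /Dform phi_lin val_subalgD val_subalgZ.
  by rewrite trace_form_linl /=; ring.
by split=> // y a x z; rewrite /= !(Dform_sym y); exact: linl.
Qed.

(** For distinct [a] and [b] the square of [E_(a,b) - E_(b,a)] has trace [-2], whence the factor
    [-1/2]. Of the four entries that arise, two detect [alpha = beta] and two detect
    [alpha = - beta]. *)
Lemma Dform_dgen alpha beta r s : Dform (dgen alpha r) (dgen beta s) =
  (r == s)%:R * ((alpha - beta == 0)%:R - (alpha + beta == 0)%:R).
Proof.
rewrite /Dform !phi_dgen !val_Gtau !opprK.
rewrite -scaleN1r addrC trace_form_linl /= !trace_form_munit.
rewrite !(entryD, entryN, entry_munit).
rewrite (_ : (r - alpha == s - beta) && (r + alpha == s + beta)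
  = (r == s) && (alpha - beta == 0)); last by lia.
rewrite (_ : (r - alpha == s + beta) && (r + alpha == s - beta)
  = (r == s) && (alpha + beta == 0)); last by lia.
rewrite (_ : (r + alpha == s - beta) && (r - alpha == s + beta)
  = (r == s) && (alpha + beta == 0)); last by lia.
rewrite (_ : (r + alpha == s + beta) && (r - alpha == s - beta)
  = (r == s) && (alpha - beta == 0)); last by lia.
by case: (r == s); rewrite /=; field.
Qed.

End Iso.

(** Linear functionals that agree on a spanning family are equal; this is applied in one variable at
    a time. *)
Lemma frakD_form_unique (B B' : frakD K -> frakD K -> K) :
  bilinear_for *%R *%R B -> bilinear_for *%R *%R B' ->
  (forall alpha beta r s,
     B (dgen alpha r) (dgen beta s) = B' (dgen alpha r) (dgen beta s)) ->
  B = B'.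
Proof.
move=> [Bl Br] [B'l B'r] BB'.
have lin0 (f : frakD K -> K) : linear_for *%R f -> f 0 = 0.
  by move=> /(_ (- 1) 0 0); rewrite scaleN1r addNr mulN1r addNr.
have eq_lin (f g : frakD K -> K) : linear_for *%R f -> linear_for *%R g ->
    (forall alpha r, f (dgen alpha r) = g (dgen alpha r)) -> f =1 g.
  move=> fl gl fg x; have : lin_span posD x by rewrite frakD_span.
  move: x; apply: lin_span_ind => [|a _ v [p _ <-] fgv].
    by rewrite (lin0 f) ?(lin0 g).
  by rewrite fl gl fg fgv.
apply/funext=> x; apply/funext=> y; move: x.
apply: (eq_lin (B^~ y) (B'^~ y)) => [||alpha r]; [exact: Bl|exact: B'l|].
by move: y; apply: eq_lin => [||beta s]; [exact: Br|exact: B'r|exact: BB'].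
Qed.

End DAtau.

Theorem lemma2p20 (R : realType) :
  (exists phi : frakD R[i] -> Atau R[i],
     lie_iso phi /\
     forall alpha r : int, phi (dgen R[i] alpha r) = Gtau R[i] (- alpha) r) /\
  (forall alpha r : int, Gtau R[i] (- alpha) r = - Gtau R[i] alpha r) /\
  basis_of_family [set p : int * int | 1 <= p.1]
    (fun p => dgen R[i] p.1 p.2) /\
  (exists B : frakD R[i] -> frakD R[i] -> R[i],
     unique (fun B' : frakD R[i] -> frakD R[i] -> R[i] =>
       bilinear_for *%R *%R B' /\
       forall alpha beta r s : int,
         B' (dgen R[i] alpha r) (dgen R[i] beta s) =
           (r == s)%:R * ((alpha - beta == 0)%:R - (alpha + beta == 0)%:R)) B /\
     form_symmetric B /\ form_invariant B).
Proof.
have two_neq0 : 2%:R != 0 :> R[i] by rewrite pnatr_eq0.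
have [phi [phi_hom phi_dgen]] := frakD_to_Atau R[i].
split; first by exists phi; split=> //; exact: phi_iso.
split; first exact: GtauN.
split; first exact: (frakD_basis two_neq0 phi_hom phi_dgen).
(* Existence and uniqueness together say that the values on generators do define a bilinear form. *)
exists (Dform phi); split; last first.
  by split; [exact: Dform_sym | exact: Dform_invariant].
have B_bilin := Dform_bilinear phi_hom.
have B_dgen := Dform_dgen two_neq0 phi_dgen.
split=> // B' [B'_bilin B'_dgen].
apply: (frakD_form_unique two_neq0 B_bilin B'_bilin) => alpha beta r s.
by rewrite B_dgen B'_dgen.
Qed.
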